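(* Fix $n\in\mathbb{N}$. Let $X_1,\dots,X_n$ be $\mathbb{Z}$-valued random variables and suppose that the law of $(X_1,\dots,X_n)$ is invariant under rotations (it may depend on $n$). Define $S_0=0$ and $S_t=\sum_{i=1}^tX_i$ for $t\in[n]$. Then for any $j\in\mathbb{N}$, $$\mathbb{P}\big(S_t>0\ \ \forall t\in[n],\ S_n=j\big)\le\frac{j}{n}\,\mathbb{P}(S_n=j).$$
   Context: $[n]=\{1,\dots,n\}$ and $\mathbb{N}=\{1,2,\dots\}$. Invariance under rotations means that for every $r\in[n]$ the vector $(X_{r+1},\dots,X_n,X_1,\dots,X_r)$ has the same law as $(X_1,\dots,X_n)$. *)

(* Defs.v *)
From HB Require Import structures.
From mathcomp Require Import all_boot all_order all_algebra.
From mathcomp Require Import all_classical all_reals all_analysis.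

Set Implicit Arguments.
Unset Strict Implicit.
Unset Printing Implicit Defensive.

Import Order.TTheory GRing.Theory Num.Theory.

Local Open Scope classical_set_scope.
Local Open Scope ring_scope.

HB.instance Definition _ := isPointed.Build int 0.

(* Discrete sigma-algebra on int, as the library does for nat. *)
HB.instance Definition _ := @isMeasurable.Build default_measure_display
  int (@discrete_measurable int) (@discrete_measurable0 int)
  (@discrete_measurableC int) (@discrete_measurableU int).

Section cyclic_walk.
Context {d : measure_display} {T : measurableType d} {R : realType}.
Variables (P : probability T R) (n : nat).

(* The ordinal i : 'I_n stands for the index i + 1 in {1, ..., n}. *)
Definition vector_of (X : 'I_n -> {RV P >-> int}) (w : T) : n.-tuple int :=
  [tuple X i w | i < n].

(* rot r (x_1, ..., x_n) = (x_(r+1), ..., x_n, x_1, ..., x_r); the two laws are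
   compared on the measurable sets of the product sigma-algebra of int^n. *)
Definition rotation_invariant (X : 'I_n -> {RV P >-> int}) : Prop :=
  forall r : nat, (1 <= r <= n)%N ->
  forall B : set (n.-tuple int), measurable B ->
    pushforward P (fun w => [tuple of rot r (vector_of X w)]) B =
    pushforward P (vector_of X) B.

Definition partial_sum (X : 'I_n -> {RV P >-> int}) (t : nat) (w : T) : int :=
  \sum_(i < n | (i < t)%N) X i w.

End cyclic_walk.

(* Main.v *)
(* If S_n = j, extend S to all indices by S_(i+n) = S_i + j. The rotation by r
   has positive partial sums exactly when S_r < S_k for all k > r. Two such
   r1 < r2 in {0, ..., n-1} satisfy S_(r1) < S_(r2) < S_(r1+n) = S_(r1) + j, so
   their values are distinct modulo j and there are at most j of them. Taking
   expectations, rotation invariance makes the n rotated events equiprobable,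
   whence n P(S > 0, S_n = j) <= j P(S_n = j). *)
Require Import Defs.
From HB Require Import structures.
From mathcomp Require Import all_boot all_order all_algebra.
From mathcomp Require Import all_classical all_reals all_analysis.
From mathcomp Require Import measurable_realfun zify.

Set Implicit Arguments.
Unset Strict Implicit.
Unset Printing Implicit Defensive.

Import Order.TTheory GRing.Theory Num.Theory.

Local Open Scope classical_set_scope.
Local Open Scope ring_scope.

(** Reduction modulo [j] is injective on the values of [s] at such indices, so the [j] residues
    bound their number. *)
Lemma card_strict_future_minima (n j : nat) (s : nat -> int) : (0 < n)%N -> (0 < j)%N ->
  (forall i, s (i + n)%N = s i + j%:Z) ->
  (#|[pred r : 'I_n | [forall t : 'I_n, (s r < s (r + t.+1)%N)%R]]| <= j)%N.
Proof.
move=> n0 j0 sn.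
have sq i q : s (i + q * n)%N = s i + q%:Z * j%:Z.
  elim: q => [|q IHq]; first by rewrite mul0n addn0 mul0r addr0.
  by rewrite mulSn addnCA addnC sn IHq; lia.
pose minima := [pred r : 'I_n | [forall t : 'I_n, (s r < s (r + t.+1)%N)%R]].
(* Membership in [minima] controls only the [n] indices after [r]. A later [k] is moved back into
   that window by a multiple of [n], which lowers [s] by a nonnegative multiple of [j]. *)
have incr (r : 'I_n) k : r \in minima -> (r < k)%N -> s r < s k.
  move=> /forallP/= r_min rk; set m := (k - r.+1)%N.
  have /= rt := r_min (Ordinal (ltn_pmod m n0)).
  have -> : k = (r + (m %% n).+1 + m %/ n * n)%N.
    by have := divn_eq m n; rewrite /m; lia.
  by rewrite sq (lt_le_trans rt) // lerDl.
have gap (r1 r2 : 'I_n) : r1 \in minima -> r2 \in minima -> (r1 < r2)%N ->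
    s r1 < s r2 < s r1 + j%:Z.
  (* The upper bound is [incr] for [r2] at the index [r1 + n], which exceeds [r2] because
     [r2 < n]. *)
  move=> L1 L2 r12; rewrite incr //= -sn incr //.
  by have := ltn_ord r2; lia.
case: j j0 sn sq gap => // j _ sn sq gap.
pose res (r : 'I_n) : 'I_j.+1 := inord `|(s r %% j.+1%:Z)%Z|.
rewrite -[X in (_ <= X)%N]card_ord;
  apply: leq_trans (max_card (mem [seq res r | r in minima])).
rewrite card_in_image // => r1 r2 L1 L2 /(congr1 (@nat_of_ord _)).
have m_ge0 r : (0 <= s r %% j.+1%:Z)%Z by rewrite modz_ge0.
have m_lt r : (s r %% j.+1%:Z < j.+1%:Z)%Z by rewrite ltz_pmod.
rewrite !inordK => [m12||]; last first.
- by have := m_ge0 r1; have := m_lt r1; lia.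
- by have := m_ge0 r2; have := m_lt r2; lia.
have {}m12 : (s r1 %% j.+1%:Z)%Z = (s r2 %% j.+1%:Z)%Z.
  by have := m_ge0 r1; have := m_ge0 r2; lia.
apply: val_inj => /=.
(* With equal remainders, the two inequalities compare quotients and would put an integer strictly
   between two consecutive ones. *)
have sep a b : (a %% j.+1%:Z = b %% j.+1%:Z)%Z -> a < b < a + j.+1%:Z -> False.
  move=> ab; rewrite (divz_eq a j.+1%:Z) (divz_eq b j.+1%:Z) ab addrAC !ltrD2r.
  by rewrite -[X in _ < _ + X]mul1r -mulrDl !ltr_pM2r // ltzD1; lia.
by case: (ltngtP r1 r2) => // r12;
  [case: (sep _ _ m12) | case: (sep _ _ (esym m12))]; apply: gap.
Qed.

(** The walk with its steps repeated periodically, so that it can be followed past the end of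
    [x]. *)
Definition cyclic_sum (x : seq int) (k : nat) : int :=
  \sum_(i < k) x`_(i %% size x).

Lemma cyclic_sumE x k : (k <= size x)%N -> cyclic_sum x k = \sum_(i < k) x`_i.
Proof.
move=> kx; apply: eq_bigr => i _.
by rewrite modn_small // (leq_trans _ kx).
Qed.

Lemma cyclic_sum_period n x k : size x = n ->
  cyclic_sum x (k + n) = cyclic_sum x k + cyclic_sum x n.
Proof.
move=> <-; elim: k => [|k IHk]; first by rewrite /cyclic_sum big_ord0 add0r.
by rewrite addSn /cyclic_sum !big_ord_recr /= -!/(cyclic_sum _ _) IHk modnDr addrAC.
Qed.

Lemma nth_rot_mod (A : Type) (x0 : A) (x : seq A) r i :
  (r <= size x)%N -> (i < size x)%N ->
  nth x0 (rot r x) i = nth x0 x ((r + i) %% size x).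
Proof.
move=> rx ix; rewrite /rot nth_cat size_drop nth_drop.
case: ltnP => ri; first by rewrite modn_small // -ltn_subRL.
rewrite nth_take; last by lia.
congr nth; rewrite -[(r + i)%N](@subnK (size x)) ?modnDr ?modn_small; lia.
Qed.

(** Rotating by [r] restarts the periodic walk at time [r]; this turns positivity after rotation
    into a comparison with the value at [r]. *)
Lemma sum_rot (x : seq int) r t : (r <= size x)%N -> (t <= size x)%N ->
  \sum_(i < t) (rot r x)`_i = cyclic_sum x (r + t) - cyclic_sum x r.
Proof.
move=> rx; elim: t => [|t IHt] tx; first by rewrite big_ord0 addn0 subrr.
rewrite big_ord_recr IHt 1?ltnW //= addnS /cyclic_sum [in RHS]big_ord_recr /=.
by rewrite nth_rot_mod // addrAC.
Qed.

Definition positive_bridge n (j : nat) (x : seq int) : bool :=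
  [forall t : 'I_n, 0 < \sum_(i < t.+1) x`_i] && (\sum_(i < n) x`_i == j%:Z).

(** Rotation preserves the total, so both sides vanish unless it equals [j]. In that case the good
    rotations are the strict future minima of [cyclic_sum x], which gains [j] over each period. *)
Lemma cycle_lemma n j (x : seq int) : size x = n -> (0 < n)%N -> (0 < j)%N ->
  (\sum_(r < n) positive_bridge n j (rot r x)
   <= j * (\sum_(i < n) x`_i == j%:Z)%R)%N.
Proof.
move=> sx n0 j0.
have bridgeE (r : 'I_n) : positive_bridge n j (rot r x) =
   [forall t : 'I_n, cyclic_sum x r < cyclic_sum x (r + t.+1)] &&
   (\sum_(i < n) x`_i == j%:Z).
  rewrite /positive_bridge; congr andb.
    apply: eq_forallb => t.
    by rewrite sum_rot ?subr_gt0 ?sx // ltnW.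
  rewrite sum_rot ?sx // 1?ltnW // cyclic_sum_period // addrAC subrr add0r.
  by rewrite cyclic_sumE ?sx.
under eq_bigr do rewrite bridgeE.
case: eqP => [sumj|_]; last first.
  by rewrite big1 // => r _; rewrite andbF.
under eq_bigr do rewrite andbT.
rewrite -big_mkcond /= sum1_card muln1 card_strict_future_minima // => i.
by rewrite cyclic_sum_period // [in X in _ + X]cyclic_sumE ?sx // sumj.
Qed.

(** The hypothesis is an inequality between sums of indicators, which is integrated against [mu]. *)
Lemma sum_measure_le_multiplicity d (T : measurableType d) (R : realType)
    (mu : {measure set T -> \bar R}) (I : finType) (E : I -> set T) (C : set T)
    (j : nat) :
  (forall i, measurable (E i)) -> measurable C ->
  (forall w, \sum_(i : I) (w \in E i) <= j * (w \in C))%N ->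
  (\sum_(i : I) mu (E i) <= j%:R%:E * mu C)%E.
Proof.
move=> mE mC le_mult.
have mu_indic A : measurable A -> mu A = (\int[mu]_w (\1_A w)%:E)%E.
  by move=> mA; rewrite integral_indic // setIT.
have m_indic (A : set T) : measurable A ->
    measurable_fun setT (fun w => (\1_A w : R)%:E).
  by move=> mA; apply/measurable_EFinP; exact: measurable_indic.
under eq_bigr do rewrite mu_indic //.
rewrite mu_indic // -ge0_integralZl_EFin //; last exact: m_indic.
rewrite -(@ge0_integral_sum _ _ _ mu _ _ _ (fun i w => (\1_(E i) w)%:E)) //;
  last by move=> i; exact: m_indic.
apply: ge0_le_integral => //.
- by move=> w _; apply: sume_ge0.
- by apply: emeasurable_sum => i; exact: m_indic.
- by apply: measurable_funeM; exact: m_indic.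
move=> w _; rewrite sumEFin -EFinM lee_fin !indicE -natrM.
under eq_bigr do rewrite indicE.
by rewrite -natr_sum ler_nat le_mult.
Qed.

(** The space is countable and each singleton is a finite intersection of coordinate preimages.
    Rotation invariance thus applies to every set of tuples. *)
Lemma measurable_tuple_int n (B : set (n.-tuple int)) : measurable B.
Proof.
apply: countable_measurable => [x|]; last exact: countableP.
have -> : [set x] = \bigcap_(i : 'I_n) ((@tnth n int ^~ i) @^-1` [set tnth x i]).
  apply/seteqP; split=> [_ -> //|y xy].
  by apply: eq_from_tnth => i; exact: xy.
apply: fin_bigcap_measurable => // i _.
rewrite -[X in measurable X]setTI.
by apply: measurable_tnth.
Qed.

Theorem lemma1p2 (d : measure_display) (T : measurableType d) (R : realType)
    (P : probability T R) (n : nat) (hn : (0 < n)%N)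
    (X : 'I_n -> {RV P >-> int}) (hX : rotation_invariant X)
    (j : nat) (hj : (0 < j)%N) :
  (P [set w | (forall t : nat, (1 <= t <= n)%N -> (0 < partial_sum X t w)%R) /\
              partial_sum X n w = j%:Z]
   <= (j%:R / n%:R)%:E * P [set w | partial_sum X n w = j%:Z])%E.
Proof.
have measurable_vector : measurable_fun setT (vector_of X).
  apply/measurable_fun_tnthP => i.
  have -> : @tnth n int ^~ i \o vector_of X = X i.
    by apply/funext => w /=; rewrite tnth_mktuple.
  exact: measurable_funPT.
have mpre (B : set (n.-tuple int)) : measurable (vector_of X @^-1` B).
  rewrite -[X in measurable X]setTI.
  by apply: measurable_vector => //; exact: measurable_tuple_int.
have partial_sumE t w : (t <= n)%N ->
    partial_sum X t w = \sum_(i < t) (vector_of X w)`_i.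
  move=> tn; rewrite (big_ord_widen n (fun i => (vector_of X w)`_i)) //.
  by apply: eq_bigr => i _; rewrite -tnth_nth tnth_mktuple.
pose bridge (r : nat) := [set x : n.-tuple int | positive_bridge n j (rot r x)].
have -> : [set w | (forall t : nat, (1 <= t <= n)%N -> (0 < partial_sum X t w)%R) /\
    partial_sum X n w = j%:Z] = vector_of X @^-1` bridge 0%N.
  apply/seteqP; split=> w; rewrite /bridge /= rot0 partial_sumE //.
    move=> [pos sumj]; rewrite /positive_bridge sumj eqxx andbT; apply/forallP => t.
    by have tn := ltn_ord t; rewrite -partial_sumE ?pos.
  move=> /andP[/forallP pos /eqP ->]; split=> // -[|t] // tn.
  by rewrite partial_sumE //; exact: (pos (Ordinal tn)).
set C := [set w | _].
have CE : C = vector_of X @^-1` [set x | \sum_(i < n) x`_i = j%:Z].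
  by apply/seteqP; split=> w; rewrite /C /= partial_sumE.
have Prot (r : 'I_n) : P (vector_of X @^-1` bridge r) =
    P (vector_of X @^-1` bridge 0%N).
  (* The invariance hypothesis starts at [r = 1]; the case [r = 0] is trivial. *)
  case: (posnP r) => [-> //|r0].
  have := hX r; rewrite r0 ltnW //= => /(_ isT (bridge 0%N)).
  rewrite /pushforward => <-; last exact: measurable_tuple_int.
  by congr (P _); apply/seteqP; split=> w; rewrite /bridge /= rot0.
have : (\sum_(r < n) P (vector_of X @^-1` bridge r) <= j%:R%:E * P C)%E.
  apply: sum_measure_le_multiplicity => [r||w]; rewrite ?CE //.
  have := cycle_lemma (size_tuple (vector_of X w)) hn hj.
  congr (_ <= _)%N.
    apply: eq_bigr => r _; congr nat_of_bool.
    by apply/idP/idP; rewrite inE.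
  congr (_ * nat_of_bool _)%N.
  by apply/idP/idP; rewrite inE => /eqP.
under eq_bigr do rewrite Prot.
(* Both probabilities are finite, so the inequality moves to the reals, where division by [n] is
   available. *)
have Afin : P (vector_of X @^-1` bridge 0%N) \is a fin_num.
  by exact: fin_num_measure.
have Cfin : P C \is a fin_num by apply: fin_num_measure; rewrite CE.
rewrite -(fineK Afin) -(fineK Cfin) sumEFin -!EFinM !lee_fin.
rewrite sumr_const card_ord => n_bridge.
by rewrite mulrAC ler_pdivlMr ?ltr0n // mulr_natr.
Qed.
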